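(* Let $\mathcal{X}$ be a separable complex Banach space and suppose that $A:D(A)\rightarrow\mathcal{X}$ generates a strongly continuous semigroup $(K(t))_{t\ge0}$ on $\mathcal{X}$ with $\|K(t)\|\le M$ for all $t\ge 0$, where $M\ge 1$. Let $m\ge 2$ be an even integer, $\delta>0$, $h>0$, $t>0$ and $x\in D(A^m)$ be fixed, and for $N\in\mathbb{N}_{\ge 1}$ let $$B_N=\frac{Me^{\delta t}}{\delta^m}\left[\frac{\Gamma\left(\frac32\right)\Gamma\left(\frac{m-1}{2}\right)}{\pi\,\Gamma\left(\frac m2\right)}-\frac{hN}{\pi\delta}\,{}_2F_1\left(\frac12,\frac m2;\frac32;-\left(\frac{hN}{\delta}\right)^2\right)\right]\|(2\delta-A)^mx\|.$$ Then $$B_N\sim\frac{Me^{\delta t}}{\pi\delta^m}\left[\frac{1}{m-1}\left(\frac{\delta}{hN}\right)^{m-1}\right]\|(2\delta-A)^mx\|\qquad\text{as}\qquad N\rightarrow\infty.$$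
   Context: $\Gamma$ is the gamma function and ${}_2F_1(a,b;c;z)$ is the Gauss hypergeometric function (for arguments $z\le -1$, its standard analytic continuation to $\mathbb{C}\setminus[1,\infty)$). $\|\cdot\|$ is the norm on $\mathcal{X}$. The notation $f(N)\sim g(N)$ as $N\to\infty$ means $f(N)=g(N)(1+o(1))$. The quantity $B_N$ is an upper bound for the truncation error of the $m$th-order trapezoidal contour-integral approximation of $\exp(At)x$ with $2N+1$ equally spaced nodes $\delta+ihk$, $-N\le k\le N$. *)

(* Defs.v *)
From Stdlib Require Import Reals Factorial ClassicalEpsilon.
From Coquelicot Require Import Coquelicot.

Open Scope R_scope.

(* Coquelicot's [CompleteNormedModule C_AbsRing] is a complex Banach space. *)

Definition separable (X : CompleteNormedModule C_AbsRing) : Prop :=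
  exists u : nat -> X, forall (x : X) (eps : posreal),
    exists n : nat, norm (minus (u n) x) < eps.

(* The operator norm, as a supremum in the extended reals: it is [p_infty]
   when [T] is unbounded. *)
Definition op_norm {X : CompleteNormedModule C_AbsRing} (T : X -> X) : Rbar :=
  Lub_Rbar (fun r => exists x : X, norm x <= 1 /\ r = norm (T x)).

(* An operator with a domain; the values of [op_fun] outside [op_dom] carry no
   meaning. *)
Record operator (X : CompleteNormedModule C_AbsRing) := mk_operator {
  op_dom : X -> Prop;
  op_fun :> X -> X
}.
Arguments mk_operator {X} _ _.
Arguments op_dom {X} _ _.
Arguments op_fun {X} _ _.

Definition op_id (X : CompleteNormedModule C_AbsRing) : operator X :=
  mk_operator (fun _ => True) (fun x => x).

Definition op_comp {X : CompleteNormedModule C_AbsRing} (S T : operator X)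
  : operator X :=
  mk_operator (fun x => op_dom T x /\ op_dom S (T x)) (fun x => S (T x)).

Fixpoint op_pow {X : CompleteNormedModule C_AbsRing} (T : operator X) (n : nat)
  : operator X :=
  match n with
  | O => op_id X
  | S k => op_comp (op_pow T k) T
  end.

(* The operator [lambda - T], with domain D(T). *)
Definition op_shift {X : CompleteNormedModule C_AbsRing} (lambda : C)
  (T : operator X) : operator X :=
  mk_operator (op_dom T) (fun x => minus (scal lambda x) (T x)).

(* Only the values [K t] with [0 <= t] matter. *)
Record is_C0_semigroup {X : CompleteNormedModule C_AbsRing} (K : R -> X -> X)
  : Prop := mk_is_C0_semigroup {
  C0_linear : forall t, 0 <= t -> is_linear (K t);
  C0_zero : forall x, K 0 x = x;
  C0_plus : forall s t x, 0 <= s -> 0 <= t -> K (s + t) x = K s (K t x);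
  C0_continuous : forall x, filterlim (fun t => K t x) (at_right 0) (locally x)
}.

(* Equality of graphs: D(A) is the set of [x] for which (K(s)x - x)/s converges
   as s -> 0+, and [A x] is that limit. *)
Definition generates {X : CompleteNormedModule C_AbsRing} (A : operator X)
  (K : R -> X -> X) : Prop :=
  is_C0_semigroup K /\
  forall x y : X,
    (op_dom A x /\ A x = y) <->
    filterlim (fun s => scal (RtoC (/ s)) (minus (K s x) x))
      (at_right 0) (locally y).

(* Euler's integral, which converges exactly for [0 < s]; the value elsewhere
   carries no meaning. *)
Definition Gamma (s : R) : R :=
  RInt_gen (fun u => Rpower u (s - 1) * exp (- u))
    (at_right 0) (Rbar_locally p_infty).

(* a (a + 1) ... (a + n - 1) *)
Fixpoint pochhammer (a : C) (n : nat) : C :=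
  match n with
  | O => RtoC 1
  | S k => (pochhammer a k * (a + RtoC (INR k)))%C
  end.

Definition hyp2F1_coef (a b c : C) (n : nat) : C :=
  (pochhammer a n * pochhammer b n
     / (pochhammer c n * RtoC (INR (fact n))))%C.

Definition analytic_on (U : C -> Prop) (f : C -> C) : Prop :=
  forall z0 : C, U z0 ->
    exists (r : posreal) (coef : nat -> C),
      forall z : C, Cmod (z - z0) < r -> is_pseries coef (z - z0)%C (f z).

Definition slit_plane (z : C) : Prop := ~ (1 <= Re z /\ Im z = 0).

(* [F] is the analytic continuation to the complex plane cut along [1, +oo) of
   the Gauss series. *)
Definition is_hyp2F1 (a b c : C) (F : C -> C) : Prop :=
  analytic_on slit_plane F /\
  forall z : C, Cmod z < 1 -> is_pseries (hyp2F1_coef a b c) z (F z).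

(* The continuation exists when [c] is not a nonpositive integer, and is unique
   on [slit_plane] by the identity theorem; the values on the cut carry no
   meaning. *)
Definition hyp2F1 (a b c : C) : C -> C :=
  epsilon (inhabits (fun _ : C => RtoC 0)) (is_hyp2F1 a b c).

(* Main.v *)
Require Import Defs.
From Stdlib Require Import Reals Factorial ClassicalEpsilon Lra Lia.
From Coquelicot Require Import Coquelicot.

(** Write m = 2 (p + 1), n = p + 1 and w = h N / delta. The bracket in B_N is
    1 / PI times the tail over [w, +oo) of the integral of (1 + y^2)^(-n), and the
    claim is the elementary fact that this tail is equivalent to
    w^(1-2n) / (2n - 1), the tail of the integral of y^(-2n). Two identities
    reduce the bracket to that tail.

    First, w 2F1(1/2, n; 3/2; -w^2) is the integral of (1 + y^2)^(-n) over [0, w].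
    Since n is an integer, the integral of (1 - z t^2)^(-n) for t in [0, 1] is
    defined for every z in the slit plane. Expanding the integrand in a binomial
    series about any point of the slit plane, with a remainder that is uniform in
    t ([binom_rem_le]), shows that this integral is analytic there and that its
    expansion at 0 is the Gauss series ([euler_int_hyp2F1]). As 2F1 is chosen
    among all analytic continuations, its value at -w^2 is obtained from an
    identity theorem along the negative axis ([analytic_unique_neg]).

    Second, Gamma(3/2) Gamma(n - 1/2) / Gamma(n) is the integral of (1 + y^2)^(-n)
    over [0, +oo) ([Gamma_quotient]): both sides satisfy the same recurrence in n,
    and the base case is the Gaussian integral ([gauss_lim]).

    The tail is then compared with c w^(1-2n) / (2n - 1) for c = 1 and for
    c = (1 + w^(-2))^(-n): the differences are monotone in w and vanish at
    infinity ([wallis_tail_le], [wallis_tail_ge]). The semigroup enters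
    only through a constant factor common to both sides. *)

Open Scope R_scope.

(** * The binomial series of (1 - w)^(-n) with a uniform remainder *)

(** The coefficient (n)_k / k! of w^k in (1 - w)^(-n). *)
Fixpoint rising (n k : nat) : R :=
  match k with
  | O => 1
  | S j => rising n j * (INR n + INR j) / (INR j + 1)
  end.

Lemma rising_ge_0 n k : 0 <= rising n k.
Proof.
  induction k as [|k IH]; simpl; [lra|].
  assert (Hk := pos_INR k); assert (Hn := pos_INR n).
  apply Rmult_le_pos; [apply Rmult_le_pos; lra|].
  apply Rlt_le, Rinv_0_lt_compat; lra.
Qed.

Lemma rising_0_S k : rising 0 (S k) = 0.
Proof.
  induction k as [|k IH]; [simpl; field|].
  change (rising 0 (S (S k)))
    with (rising 0 (S k) * (INR 0 + INR (S k)) / (INR (S k) + 1)).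
  rewrite IH. unfold Rdiv; ring.
Qed.

(** Coefficientwise form of (1 - w) (1 - w)^(-n-1) = (1 - w)^(-n). *)
Lemma rising_pascal n k :
  rising (S n) (S k) = rising (S n) k + rising n (S k).
Proof.
  (* Raising n by one: (n+1)_j n = (n)_j (n + j). *)
  assert (Hlow : forall j, rising (S n) j * INR n = rising n j * (INR n + INR j)).
  { induction j as [|j IH]; [simpl; ring|].
    assert (Hj := pos_INR j).
    change (rising (S n) (S j)) with (rising (S n) j * (INR (S n) + INR j) / (INR j + 1)).
    change (rising n (S j)) with (rising n j * (INR n + INR j) / (INR j + 1)).
    rewrite <- IH, !S_INR. field. lra. }
  assert (Hk := pos_INR k).
  change (rising (S n) (S k)) with (rising (S n) k * (INR (S n) + INR k) / (INR k + 1)).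
  change (rising n (S k)) with (rising n k * (INR n + INR k) / (INR k + 1)).
  rewrite <- Hlow, S_INR. field. lra.
Qed.

Fixpoint binom_sum (n : nat) (w : C) (K : nat) : C :=
  match K with
  | O => RtoC 1
  | S j => (binom_sum n w j + RtoC (rising n (S j)) * w ^ S j)%C
  end.

Definition binom_rem (n K : nat) (w : C) : C :=
  (/ (1 - w) ^ n - binom_sum n w K)%C.

Lemma binom_rem_0 (K : nat) (w : C) : binom_rem 0 K w = RtoC 0.
Proof.
  unfold binom_rem.
  assert (E : binom_sum 0 w K = RtoC 1).
  { induction K as [|K IH]; [reflexivity|].
    cbn [binom_sum]. rewrite IH.
    rewrite rising_0_S. ring. }
  rewrite E. simpl. field.
Qed.

(** The partial sums inherit the relation between exponents n and n+1, up to
    the last term that the multiplication by 1 - w pushes past K. *)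
Lemma binom_sum_S (n K : nat) (w : C) :
  ((1 - w) * binom_sum (S n) w K =
   binom_sum n w K - RtoC (rising (S n) K) * w ^ S K)%C.
Proof.
  induction K as [|K IH].
  - simpl. ring.
  - cbn [binom_sum]. rewrite Cmult_plus_distr_l, IH, rising_pascal, RtoC_plus.
    simpl. ring.
Qed.

Lemma binom_rem_S (n K : nat) (w : C) :
  (1 - w <> 0)%C ->
  ((1 - w) * binom_rem (S n) K w =
   binom_rem n K w + RtoC (rising (S n) K) * w ^ S K)%C.
Proof.
  intros Hw. unfold binom_rem.
  replace ((1 - w) * (/ (1 - w) ^ S n - binom_sum (S n) w K))%C
    with ((1 - w) * / (1 - w) ^ S n - (1 - w) * binom_sum (S n) w K)%C by ring.
  rewrite binom_sum_S.
  replace ((1 - w) * / (1 - w) ^ S n)%C with (/ (1 - w) ^ n)%C.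
  - ring.
  - rewrite Cpow_S. field. split; [apply Cpow_nz|]; assumption.
Qed.


(** Each term of a series with nonnegative terms is at most its sum, here
    (1 - q)^(-n); Pascal's rule gives this bound without knowing the sum. *)
Lemma rising_pow_le (n k : nat) (q : R) :
  0 <= q < 1 -> rising n k * q ^ k <= / (1 - q) ^ n.
Proof.
  intros Hq. revert k. induction n as [|n IHn]; intros k.
  - change ((1 - q) ^ 0) with 1. rewrite Rinv_1.
    destruct k as [|k]; [simpl; lra|].
    rewrite rising_0_S; lra.
  - assert (Hpos : 0 < / (1 - q) ^ S n)
      by (apply Rinv_0_lt_compat, pow_lt; lra).
    assert (E : / (1 - q) ^ n = (1 - q) * / (1 - q) ^ S n).
    { simpl. field. split; [apply pow_nonzero|]; lra. }
    induction k as [|k IHk].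
    + change (rising (S n) 0 * q ^ 0) with (1 * 1). rewrite Rmult_1_r.
      apply Rle_trans with (/ 1); [lra|].
      apply Rinv_le_contravar; [apply pow_lt; lra|].
      replace 1 with (1 ^ S n) at 2 by apply pow1. apply pow_incr. lra.
    + rewrite rising_pascal.
      specialize (IHn (S k)). rewrite E in IHn.
      replace ((rising (S n) k + rising n (S k)) * q ^ S k)
        with (q * (rising (S n) k * q ^ k) + rising n (S k) * q ^ S k)
        by (simpl; ring).
      apply Rle_trans with (q * / (1 - q) ^ S n + (1 - q) * / (1 - q) ^ S n);
        [|right; ring].
      apply Rplus_le_compat; [apply Rmult_le_compat_l; [lra|exact IHk] | exact IHn].
Qed.

(** For q < p < 1 the terms at p are bounded, so the terms at q are dominated
    by a geometric sequence of ratio q / p. *)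
Lemma rising_pow_lim (n : nat) (q : R) :
  0 <= q < 1 -> is_lim_seq (fun k => rising n k * q ^ k) 0.
Proof.
  intros Hq. set (p := (1 + q) / 2).
  assert (Hp : 0 < p < 1) by (unfold p; lra).
  assert (Hr : 0 <= q / p < 1).
  { split; [apply Rmult_le_pos; [lra | apply Rlt_le, Rinv_0_lt_compat; lra]|].
    apply Rmult_lt_reg_r with p; [lra|]. unfold Rdiv.
    rewrite Rmult_assoc, Rinv_l by lra. unfold p; lra. }
  apply is_lim_seq_le_le with (fun _ => 0) (fun k => / (1 - p) ^ n * (q / p) ^ k).
  - intros k. split.
    + apply Rmult_le_pos; [apply rising_ge_0 | apply pow_le; lra].
    + replace (q ^ k) with (p ^ k * (q / p) ^ k).
      * rewrite <- Rmult_assoc. apply Rmult_le_compat_r; [apply pow_le; lra|].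
        apply rising_pow_le; lra.
      * rewrite <- Rpow_mult_distr. f_equal. field. lra.
  - apply is_lim_seq_const.
  - replace (Finite 0) with (Rbar_mult (/ (1 - p) ^ n) 0) by (simpl; f_equal; ring).
    apply is_lim_seq_scal_l, is_lim_seq_geom. rewrite Rabs_pos_eq; lra.
Qed.

(** The bound obtained from [binom_rem_S] by taking moduli on both sides. It is
    independent of w in the disk of radius q, which is what allows integration of
    the binomial series term by term. *)
Fixpoint binom_bound (n K : nat) (q : R) : R :=
  match n with
  | O => 0
  | S p => (binom_bound p K q + rising (S p) K * q ^ S K) / (1 - q)
  end.

Lemma one_minus_neq_0 (w : C) : Cmod w < 1 -> (1 - w)%C <> 0.
Proof.
  intros Hw E. assert (Ew : w = RtoC 1).
  { replace w with (1 - (1 - w))%C by ring. rewrite E. ring. }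
  rewrite Ew, Cmod_1 in Hw. lra.
Qed.

Lemma binom_rem_le (n K : nat) (w : C) (q : R) :
  Cmod w <= q -> q < 1 -> Cmod (binom_rem n K w) <= binom_bound n K q.
Proof.
  intros Hw Hq. assert (H0 := Cmod_ge_0 w).
  induction n as [|n IH].
  - rewrite binom_rem_0, Cmod_0. simpl. lra.
  - change (binom_bound (S n) K q)
      with ((binom_bound n K q + rising (S n) K * q ^ S K) / (1 - q)).
    apply Rmult_le_reg_r with (1 - q); [lra|].
    unfold Rdiv. rewrite Rmult_assoc, Rinv_l, Rmult_1_r by lra.
    apply Rle_trans with (Cmod ((1 - w) * binom_rem (S n) K w)).
    + rewrite Cmod_mult, Rmult_comm. apply Rmult_le_compat_r; [apply Cmod_ge_0|].
      assert (T := Cmod_triangle (1 - w) w).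
      replace (1 - w + w)%C with (RtoC 1) in T by ring.
      rewrite Cmod_1 in T. lra.
    + rewrite binom_rem_S by (apply one_minus_neq_0; lra).
      eapply Rle_trans; [apply Cmod_triangle|].
      apply Rplus_le_compat; [exact IH|].
      rewrite Cmod_mult, Cmod_R, Cmod_pow, Rabs_pos_eq by apply rising_ge_0.
      apply Rmult_le_compat_l; [apply rising_ge_0|].
      apply pow_incr; lra.
Qed.

Lemma binom_bound_lim (n : nat) (q : R) :
  0 <= q < 1 -> is_lim_seq (fun K => binom_bound n K q) 0.
Proof.
  intros Hq. induction n as [|n IH]; simpl binom_bound; [apply is_lim_seq_const|].
  replace (Finite 0) with (Rbar_mult (Finite (0 + q * 0)) (/ (1 - q)))
    by (simpl; f_equal; ring).
  apply is_lim_seq_scal_r.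
  apply is_lim_seq_plus'; [exact IH|].
  apply is_lim_seq_ext with (fun K => q * (rising (S n) K * q ^ K)).
  - intros K. simpl pow. ring.
  - apply (is_lim_seq_scal_l _ q 0), rising_pow_lim, Hq.
Qed.

(** * Complex-valued integrals and series *)

Notation Ccontinuous f t := (continuous (U := C_UniformSpace) f t).
Notation is_CRInt f a b l := (is_RInt (V := C_R_NormedModule) f a b l).
Notation CRInt f a b := (RInt (V := C_R_CompleteNormedModule) f a b).

Lemma Ccontinuous_pair (f : R -> C) (t : R) :
  continuous (fun u => Re (f u)) t -> continuous (fun u => Im (f u)) t ->
  Ccontinuous f t.
Proof.
  intros Hr Hi. apply filterlim_locally. intros eps.
  apply filterlim_locally with (eps := eps) in Hr.
  apply filterlim_locally with (eps := eps) in Hi.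
  generalize (filter_and _ _ Hr Hi). apply filter_imp.
  intros u [H1 H2]. split; assumption.
Qed.

Lemma Ccontinuous_Re (f : R -> C) (t : R) :
  Ccontinuous f t -> continuous (fun u => Re (f u)) t.
Proof.
  intros H. apply (continuous_comp f fst t H).
  destruct (f t). apply continuous_fst.
Qed.

Lemma Ccontinuous_Im (f : R -> C) (t : R) :
  Ccontinuous f t -> continuous (fun u => Im (f u)) t.
Proof.
  intros H. apply (continuous_comp f snd t H).
  destruct (f t). apply continuous_snd.
Qed.

Lemma Ccontinuous_mult (f g : R -> C) (t : R) :
  Ccontinuous f t -> Ccontinuous g t -> Ccontinuous (fun u => (f u * g u)%C) t.
Proof.
  intros Hf Hg.
  assert (H1 := Ccontinuous_Re _ _ Hf). assert (H2 := Ccontinuous_Im _ _ Hf).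
  assert (H3 := Ccontinuous_Re _ _ Hg). assert (H4 := Ccontinuous_Im _ _ Hg).
  apply Ccontinuous_pair; simpl.
  - apply (continuous_minus (V := R_NormedModule)).
    + exact (continuous_mult (K := R_AbsRing) _ _ _ H1 H3).
    + exact (continuous_mult (K := R_AbsRing) _ _ _ H2 H4).
  - apply (continuous_plus (V := R_NormedModule)).
    + exact (continuous_mult (K := R_AbsRing) _ _ _ H1 H4).
    + exact (continuous_mult (K := R_AbsRing) _ _ _ H2 H3).
Qed.

Lemma Ccontinuous_pow (f : R -> C) (n : nat) (t : R) :
  Ccontinuous f t -> Ccontinuous (fun u => (f u ^ n)%C) t.
Proof.
  intros Hf. induction n as [|n IH]; simpl.
  - apply (continuous_const (V := C_UniformSpace)).
  - apply Ccontinuous_mult; assumption.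
Qed.

Lemma Ccontinuous_inv (f : R -> C) (t : R) :
  f t <> RtoC 0 -> Ccontinuous f t -> Ccontinuous (fun u => (/ f u)%C) t.
Proof.
  intros Hz Hf.
  assert (H1 := Ccontinuous_Re _ _ Hf). assert (H2 := Ccontinuous_Im _ _ Hf).
  assert (Hn : Re (f t) ^ 2 + Im (f t) ^ 2 <> 0).
  { rewrite <- Cmod2_alt. apply pow_nonzero.
    intros E. apply Hz, Cmod_eq_0, E. }
  assert (H3 : continuous (fun u => / (Re (f u) ^ 2 + Im (f u) ^ 2)) t).
  { apply (continuous_comp (fun u => Re (f u) ^ 2 + Im (f u) ^ 2) Rinv).
    - apply (continuous_plus (V := R_NormedModule)); simpl;
        repeat (apply (continuous_mult (K := R_AbsRing)); try assumption);
        apply continuous_const.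
    - apply continuous_Rinv, Hn. }
  apply Ccontinuous_pair.
  - exact (continuous_mult (K := R_AbsRing) _ _ _ H1 H3).
  - refine (continuous_mult (K := R_AbsRing) _ _ _ _ H3).
    exact (continuous_opp (V := R_NormedModule) _ _ H2).
Qed.

(** Coquelicot's product norm on C, seen as a real normed space, is the modulus;
    thus norm estimates for integrals become modulus estimates. *)
Lemma CR_norm (z : C) : norm (V := C_R_NormedModule) z = Cmod z.
Proof.
  unfold norm; simpl. unfold prod_norm, Cmod, norm; simpl. unfold abs; simpl.
  f_equal. rewrite !Rmult_1_r, <- !Rabs_mult, !Rabs_pos_eq; try reflexivity;
  apply Rle_0_sqr.
Qed.

Lemma is_CRInt_pair (f : R -> C) (a b : R) (l : C) :
  is_RInt (fun t => Re (f t)) a b (Re l) ->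
  is_RInt (fun t => Im (f t)) a b (Im l) -> is_CRInt f a b l.
Proof.
  intros H1 H2. destruct l as [l1 l2].
  exact (is_RInt_fct_extend_pair (U := R_NormedModule) (V := R_NormedModule)
           f a b l1 l2 H1 H2).
Qed.

Lemma is_CRInt_scal (c : C) (f : R -> C) (a b : R) (l : C) :
  is_CRInt f a b l -> is_CRInt (fun t => c * f t)%C a b (c * l)%C.
Proof.
  intros H.
  assert (H1 : is_RInt (fun t => Re (f t)) a b (Re l))
    by exact (is_RInt_fct_extend_fst (U := R_NormedModule) (V := R_NormedModule) f a b l H).
  assert (H2 : is_RInt (fun t => Im (f t)) a b (Im l))
    by exact (is_RInt_fct_extend_snd (U := R_NormedModule) (V := R_NormedModule) f a b l H).
  apply is_CRInt_pair; simpl.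
  - apply (is_RInt_minus (V := R_NormedModule));
      apply (is_RInt_scal (V := R_NormedModule)); assumption.
  - apply (is_RInt_plus (V := R_NormedModule));
      apply (is_RInt_scal (V := R_NormedModule)); assumption.
Qed.

Lemma CRInt_correct (f : R -> C) :
  (forall t, 0 <= t <= 1 -> Ccontinuous f t) -> is_CRInt f 0 1 (CRInt f 0 1).
Proof.
  intros H. apply (RInt_correct (V := C_R_CompleteNormedModule)).
  apply (ex_RInt_continuous (V := C_R_CompleteNormedModule)).
  intros t Ht. rewrite Rmin_left, Rmax_right in Ht by lra. apply H, Ht.
Qed.

(** Convergence from an explicit bound on the remainders. *)
Lemma is_series_Cmod (a : nat -> C) (l : C) (u : nat -> R) :
  (forall K, Cmod (sum_n (G := C_AbelianMonoid) a K - l) <= u K) ->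
  is_lim_seq u 0 -> is_series (V := C_NormedModule) a l.
Proof.
  intros Ha Hu. apply (filterlim_locally_ball_norm (U := C_NormedModule)).
  intros eps. apply is_lim_seq_spec in Hu.
  generalize (Hu eps). apply filter_imp. intros K HK.
  change (Cmod (sum_n (G := C_AbelianMonoid) a K - l) < eps).
  apply Rle_lt_trans with (u K); [exact (Ha K)|].
  rewrite Rminus_0_r in HK. eapply Rle_lt_trans; [apply Rle_abs | exact HK].
Qed.

Lemma Cpow_n_eq (x : C) (k : nat) : pow_n (K := C_AbsRing) x k = (x ^ k)%C.
Proof.
  induction k as [|k IH]; [reflexivity|].
  simpl. rewrite IH. reflexivity.
Qed.

(** * Euler's integral continues the Gauss series to the slit plane *)

(** The integrand of the integral of (1 - z t^2)^(-n) over [0, 1], which is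
    2F1(1/2, n; 3/2; z) after the substitution s = t^2 in Euler's integral. *)
Definition euler_kernel (n : nat) (z : C) (t : R) : C :=
  (/ (1 - z * RtoC (t * t)) ^ n)%C.

Definition euler_int (n : nat) (z : C) : C := CRInt (euler_kernel n z) 0 1.

(** The coefficient of (z - z0)^k in the expansion of (1 - z t^2)^(-n) about z0. *)
Definition euler_term (n : nat) (z0 : C) (k : nat) (t : R) : C :=
  (RtoC (rising n k) * (RtoC (t * t) ^ k * euler_kernel (n + k) z0 t))%C.

Definition euler_coef (n : nat) (z0 : C) (k : nat) : C :=
  CRInt (euler_term n z0 k) 0 1.

Lemma Ccontinuous_sq (t : R) : Ccontinuous (fun u => RtoC (u * u)) t.
Proof.
  apply Ccontinuous_pair; simpl.
  - apply (continuous_mult (K := R_AbsRing)); apply continuous_id.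
  - apply continuous_const.
Qed.

Lemma continuous_euler_kernel (n : nat) (z : C) (t : R) :
  (1 - z * RtoC (t * t) <> 0)%C -> Ccontinuous (euler_kernel n z) t.
Proof.
  intros Hz. apply Ccontinuous_inv; [apply Cpow_nz, Hz|].
  apply Ccontinuous_pow.
  apply (continuous_minus (V := C_R_NormedModule)).
  - apply (continuous_const (V := C_UniformSpace)).
  - apply Ccontinuous_mult; [apply (continuous_const (V := C_UniformSpace)) | apply Ccontinuous_sq].
Qed.

Lemma continuous_euler_term (n : nat) (z0 : C) (k : nat) (t : R) :
  (1 - z0 * RtoC (t * t) <> 0)%C -> Ccontinuous (euler_term n z0 k) t.
Proof.
  intros Hz. apply Ccontinuous_mult; [apply (continuous_const (V := C_UniformSpace))|].
  apply Ccontinuous_mult; [apply Ccontinuous_pow, Ccontinuous_sq|].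
  apply continuous_euler_kernel, Hz.
Qed.

(** With d = 1 - z0 t^2 and w = v t^2 / d, the expansion about z0 is d^(-n) times
    the binomial series in w. *)
Lemma euler_term_sum (n K : nat) (z0 v : C) (t : R) :
  (1 - z0 * RtoC (t * t) <> 0)%C ->
  @eq C (sum_n (G := C_AbelianMonoid) (fun k => v ^ k * euler_term n z0 k t)%C K)
  (euler_kernel n z0 t *
     binom_sum n (v * RtoC (t * t) / (1 - z0 * RtoC (t * t))) K)%C.
Proof.
  intros Hz. induction K as [|K IH].
  - rewrite sum_O. unfold euler_term. rewrite Nat.add_0_r. simpl. ring.
  - rewrite sum_Sn, IH. cbn [binom_sum]. change plus with Cplus.
    unfold euler_term, euler_kernel.
    rewrite Cpow_add_r. unfold Cdiv. rewrite !Cpow_mult_l, Cpow_inv by exact Hz.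
    set (d := (1 - z0 * RtoC (t * t))%C) in *.
    assert (Hn := Cpow_nz d n Hz). assert (Hk := Cpow_nz d (S K) Hz).
    set (s := binom_sum _ _ _). field. split; assumption.
Qed.

Lemma euler_kernel_shift (n : nat) (z0 z : C) (t : R) :
  (1 - z0 * RtoC (t * t) <> 0)%C ->
  Cmod ((z - z0) * RtoC (t * t) / (1 - z0 * RtoC (t * t))) < 1 ->
  euler_kernel n z t =
  (euler_kernel n z0 t *
     / (1 - (z - z0) * RtoC (t * t) / (1 - z0 * RtoC (t * t))) ^ n)%C.
Proof.
  intros Hz Hw. unfold euler_kernel.
  apply one_minus_neq_0 in Hw.
  set (w := ((z - z0) * RtoC (t * t) / (1 - z0 * RtoC (t * t)))%C) in *.
  replace (1 - z * RtoC (t * t))%C with ((1 - z0 * RtoC (t * t)) * (1 - w))%C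
    by (unfold w; field; exact Hz).
  rewrite Cpow_mult_l. field. split; apply Cpow_nz; assumption.
Qed.

(** Writing 1 - z t^2 = d (1 - w) with d = 1 - z0 t^2 and |w| <= q < 1 for all t in
    [0, 1], the binomial series in w converges uniformly in t and is integrated
    term by term. The hypotheses cover both uses: the Gauss series (z0 = 0, c = 1,
    q = |z|) and the local expansions at points of the slit plane (q = 1/2). *)
Lemma euler_int_pseries (n : nat) (z0 z : C) (c q : R) :
  0 < c -> 0 <= q < 1 ->
  (forall t, 0 <= t <= 1 -> c <= Cmod (1 - z0 * RtoC (t * t))) ->
  Cmod (z - z0) <= q * c ->
  is_pseries (V := C_NormedModule) (euler_coef n z0) (z - z0)%C (euler_int n z).
Proof.
  intros Hc Hq Hd Hz.
  assert (Hd0 : forall t, 0 <= t <= 1 -> (1 - z0 * RtoC (t * t) <> 0)%C).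
  { intros t Ht E. specialize (Hd t Ht). rewrite E, Cmod_0 in Hd. lra. }
  assert (Hw : forall t, 0 <= t <= 1 ->
    Cmod ((z - z0) * RtoC (t * t) / (1 - z0 * RtoC (t * t))) <= q).
  { intros t Ht. specialize (Hd t Ht). specialize (Hd0 t Ht).
    unfold Cdiv. rewrite !Cmod_mult, Cmod_inv, Cmod_R by exact Hd0.
    apply Rmult_le_reg_r with (Cmod (1 - z0 * RtoC (t * t))); [lra|].
    rewrite Rmult_assoc, Rinv_l by lra.
    assert (Rabs (t * t) <= 1) by (rewrite Rabs_pos_eq; nra).
    assert (H1 := Rabs_pos (t * t)). assert (H2 := Cmod_ge_0 (z - z0)).
    nra. }
  assert (Hker : is_CRInt (euler_kernel n z) 0 1 (euler_int n z)).
  { apply CRInt_correct. intros t Ht. apply continuous_euler_kernel.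
    replace (1 - z * RtoC (t * t))%C with
      ((1 - z0 * RtoC (t * t)) *
         (1 - (z - z0) * RtoC (t * t) / (1 - z0 * RtoC (t * t))))%C
      by (field; apply Hd0, Ht).
    apply Cmult_neq_0; [apply Hd0, Ht|].
    apply one_minus_neq_0. specialize (Hw t Ht). lra. }
  assert (Hsum : forall K, is_CRInt
    (fun t => sum_n (G := C_AbelianMonoid) (fun k => (z - z0) ^ k * euler_term n z0 k t)%C K)
    0 1 (sum_n (G := C_AbelianMonoid) (fun k => (z - z0) ^ k * euler_coef n z0 k)%C K)).
  { assert (H1 : forall k, is_CRInt (fun t => (z - z0) ^ k * euler_term n z0 k t)%C 0 1
                   ((z - z0) ^ k * euler_coef n z0 k)%C).
    { intros k. apply is_CRInt_scal, CRInt_correct.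
      intros t Ht. apply continuous_euler_term, Hd0, Ht. }
    induction K as [|K IH].
    - rewrite sum_O.
      eapply (is_RInt_ext (V := C_R_NormedModule)); [|apply (H1 O)].
      intros t _. rewrite sum_O. reflexivity.
    - rewrite sum_Sn.
      eapply (is_RInt_ext (V := C_R_NormedModule));
        [|apply (is_RInt_plus (V := C_R_NormedModule) _ _ _ _ _ _ IH (H1 (S K)))].
      intros t _. rewrite sum_Sn. reflexivity. }
  apply is_series_Cmod with (fun K => / c ^ n * binom_bound n K q).
  - intros K.
    replace (sum_n _ K) with
      (sum_n (G := C_AbelianMonoid) (fun k => (z - z0) ^ k * euler_coef n z0 k)%C K)
      by (apply sum_n_ext; intros k; symmetry; exact (f_equal (fun u => (u * euler_coef n z0 k)%C) (Cpow_n_eq (z - z0) k))).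
    assert (Hdiff := is_RInt_minus (V := C_R_NormedModule) _ _ _ _ _ _ (Hsum K) Hker).
    apply norm_RInt_le_const with (M := / c ^ n * binom_bound n K q) in Hdiff;
      [|lra|].
    + rewrite CR_norm in Hdiff. rewrite Rminus_0_r, Rmult_1_l in Hdiff. exact Hdiff.
    + intros t Ht. rewrite CR_norm, euler_term_sum by (apply Hd0, Ht).
      rewrite (euler_kernel_shift n z0 z t);
        [|apply Hd0, Ht | specialize (Hw t Ht); lra].
      set (w := ((z - z0) * RtoC (t * t) / (1 - z0 * RtoC (t * t)))%C) in *.
      replace (minus _ _) with (- (euler_kernel n z0 t * binom_rem n K w))%C
        by (unfold binom_rem; change minus with Cminus; ring).
      rewrite Cmod_opp, Cmod_mult.
      apply Rmult_le_compat; try apply Cmod_ge_0.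
      * unfold euler_kernel. rewrite Cmod_inv, Cmod_pow by (apply Cpow_nz, Hd0, Ht).
        apply Rinv_le_contravar; [apply pow_lt, Hc|].
        apply pow_incr. split; [lra | apply Hd, Ht].
      * apply binom_rem_le; [apply Hw, Ht | lra].
  - replace (Finite 0) with (Rbar_mult (/ c ^ n) 0) by (simpl; f_equal; ring).
    apply is_lim_seq_scal_l, binom_bound_lim, Hq.
Qed.

Lemma is_RInt_pow_01 (k : nat) :
  is_RInt (fun t => (t * t) ^ k) 0 1 (/ (2 * INR k + 1)).
Proof.
  assert (Hk := pos_INR k).
  replace (/ (2 * INR k + 1))
    with (1 ^ (2 * k + 1) / (2 * INR k + 1) - 0 ^ (2 * k + 1) / (2 * INR k + 1)).
  - apply (is_RInt_derive (V := R_CompleteNormedModule)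
      (fun t => t ^ (2 * k + 1) / (2 * INR k + 1)) (fun t => (t * t) ^ k)).
    + intros t _. auto_derive; [exact I|].
      replace (Init.Nat.pred (k + (k + 0) + 1)) with (k + k)%nat by lia.
      rewrite Rpow_mult_distr, <- pow_add.
      replace (INR (k + (k + 0) + 1)) with (2 * INR k + 1)
        by (rewrite !plus_INR; simpl; ring).
      field. lra.
    + intros t _. apply (ex_derive_continuous (V := R_NormedModule)).
      auto_derive. exact I.
  - rewrite pow1, pow_i by lia. field. lra.
Qed.

Lemma is_CRInt_RtoC (f : R -> R) (a b l : R) :
  is_RInt f a b l -> is_CRInt (fun t => RtoC (f t)) a b (RtoC l).
Proof.
  intros H. apply is_CRInt_pair; [exact H|].
  assert (H0 := is_RInt_const (V := R_NormedModule) a b 0).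
  change (is_RInt (fun _ : R => 0) a b ((b - a) * 0)) in H0.
  rewrite Rmult_0_r in H0. exact H0.
Qed.

(** (1/2)_k / (3/2)_k telescopes to 1 / (2k + 1), the integral of t^(2k). *)
Lemma pochhammer_half (k : nat) :
  (RtoC (2 * INR k + 1) * pochhammer (RtoC (1 / 2)) k)%C = pochhammer (RtoC (3 / 2)) k.
Proof.
  induction k as [|k IH].
  - simpl. rewrite <- RtoC_mult. f_equal. ring.
  - cbn [pochhammer]. rewrite <- IH, <- !RtoC_plus.
    replace (2 * INR (S k) + 1) with (2 * (3 / 2 + INR k)) by (rewrite S_INR; field).
    replace (2 * INR k + 1) with (2 * (1 / 2 + INR k)) by field.
    rewrite !RtoC_mult. ring.
Qed.

Lemma pochhammer_pos_neq_0 (a : R) (k : nat) :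
  0 < a -> pochhammer (RtoC a) k <> RtoC 0.
Proof.
  intros Ha. induction k as [|k IH]; simpl.
  - intros E. apply RtoC_inj in E. lra.
  - apply Cmult_neq_0; [exact IH|]. rewrite <- RtoC_plus.
    intros E. apply RtoC_inj in E. assert (Hk := pos_INR k). lra.
Qed.

Lemma pochhammer_rising (n k : nat) :
  pochhammer (RtoC (INR n)) k = RtoC (rising n k * INR (fact k)).
Proof.
  induction k as [|k IH].
  - simpl. f_equal. ring.
  - cbn [pochhammer]. rewrite IH, <- RtoC_plus, <- RtoC_mult. f_equal.
    rewrite fact_simpl, mult_INR, S_INR. simpl rising. field.
    assert (Hk := pos_INR k). lra.
Qed.

Lemma hyp2F1_coef_half (n k : nat) :
  hyp2F1_coef (RtoC (1 / 2)) (RtoC (INR n)) (RtoC (3 / 2)) k = euler_coef n (RtoC 0) k.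
Proof.
  assert (Hk := pos_INR k).
  transitivity (RtoC (rising n k) * RtoC (/ (2 * INR k + 1)))%C.
  - unfold hyp2F1_coef. rewrite <- pochhammer_half, pochhammer_rising, RtoC_mult, RtoC_inv by lra.
    field. split; [intros E; apply RtoC_inj in E; lra|]. split; [intros E; apply RtoC_inj in E; exact (INR_fact_neq_0 k E)|].
    apply pochhammer_pos_neq_0. lra.
  - symmetry. apply (is_RInt_unique (V := C_R_CompleteNormedModule)).
    apply is_CRInt_scal.
    apply (is_RInt_ext (V := C_R_NormedModule) (fun t => RtoC ((t * t) ^ k))).
    + intros t _. unfold euler_kernel. rewrite RtoC_pow.
      replace (1 - 0 * RtoC (t * t))%C with (RtoC 1) by ring.
      rewrite Cpow_1_l. refine (_ : @eq C _ _). field.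
    + apply is_CRInt_RtoC, is_RInt_pow_01.
Qed.

(** For z off the cut, 1 - z s has no zero on the compact [0, 1], so its modulus
    attains a positive minimum there. *)
Lemma slit_plane_bound (z : C) :
  slit_plane z ->
  exists c, 0 < c /\ forall t, 0 <= t <= 1 -> c <= Cmod (1 - z * RtoC (t * t)).
Proof.
  intros Hz.
  set (g := fun t => Cmod (1 - z * RtoC (t * t))).
  assert (Hsq : forall t, g t ^ 2 = (1 - Re z * (t * t)) ^ 2 + (Im z * (t * t)) ^ 2).
  { intros t. unfold g. rewrite Cmod2_alt. destruct z as [a b]. simpl. ring. }
  assert (Hcont : forall t, continuity_pt
            (fun t => sqrt ((1 - Re z * (t * t)) ^ 2 + (Im z * (t * t)) ^ 2)) t).
  { intros t. apply continuity_pt_filterlim.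
    apply (continuous_comp
      (fun t => (1 - Re z * (t * t)) ^ 2 + (Im z * (t * t)) ^ 2) sqrt).
    - apply (ex_derive_continuous (V := R_NormedModule)). auto_derive. exact I.
    - apply continuous_sqrt. }
  destruct (continuity_ab_min _ 0 1 Rle_0_1 (fun t _ => Hcont t)) as [t0 [Hmin Ht0]].
  assert (Hg : forall t, g t = sqrt ((1 - Re z * (t * t)) ^ 2 + (Im z * (t * t)) ^ 2)).
  { intros t. rewrite <- Hsq. symmetry. apply sqrt_pow2, Cmod_ge_0. }
  exists (g t0). split.
  - destruct (Cmod_ge_0 (1 - z * RtoC (t0 * t0))) as [H|H]; [exact H|].
    exfalso. apply Hz. symmetry in H.
    assert (E := Hsq t0). unfold g in E. rewrite H in E.
    assert (E1 : Re z * (t0 * t0) = 1) by nra.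
    assert (E2 : Im z * (t0 * t0) = 0) by nra.
    assert (Hu : 0 <= t0 * t0 <= 1) by nra.
    assert (Hu0 : t0 * t0 <> 0) by (intros E0; rewrite E0 in E1; lra).
    split.
    + apply Rmult_le_reg_r with (t0 * t0); lra.
    + destruct (Rmult_integral _ _ E2) as [E3|E3]; [exact E3 | contradiction].
  - intros t Ht. fold (g t). rewrite !Hg. apply Hmin, Ht.
Qed.

Lemma euler_int_hyp2F1 (n : nat) :
  is_hyp2F1 (RtoC (1 / 2)) (RtoC (INR n)) (RtoC (3 / 2)) (euler_int n).
Proof.
  split.
  - intros z0 Hz0. destruct (slit_plane_bound z0 Hz0) as [c [Hc Hd]].
    assert (Hr : 0 < 1 / 2 * c) by lra.
    exists (mkposreal _ Hr), (euler_coef n z0). intros z Hz. simpl in Hz.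
    apply euler_int_pseries with c (1 / 2); lra || assumption.
  - intros z Hz. assert (H0 := Cmod_ge_0 z).
    apply (is_series_ext (V := C_NormedModule)
      (fun k => scal (pow_n (K := C_AbsRing) (z - 0)%C k) (euler_coef n (RtoC 0) k))).
    + intros k. rewrite hyp2F1_coef_half. do 2 f_equal. ring.
    + apply (euler_int_pseries n (RtoC 0) z 1 (Cmod z)); try lra.
      * intros t _. replace (1 - 0 * RtoC (t * t))%C with (RtoC 1) by ring.
        rewrite Cmod_1. lra.
      * replace (z - 0)%C with z by ring. lra.
Qed.

(** * Uniqueness of the continuation on the negative axis *)

(** The sum of a power series is continuous at 0, where its value is the constant
    coefficient, and a one-sided neighbourhood of 0 suffices to compute the limit. *)
Lemma pseries_zero_right_0 (b : nat -> R) (r : R) :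
  0 < r -> (forall y, 0 < y < r -> is_pseries b y 0) -> b O = 0.
Proof.
  intros Hr Hb.
  assert (Hc : continuity_pt (PSeries b) 0).
  { apply PSeries_continuity. rewrite Rabs_R0.
    apply Rbar_lt_le_trans with (Finite (r / 2)); [simpl; lra|].
    rewrite <- (Rabs_pos_eq (r / 2)) by lra.
    apply Rbar_not_lt_le. intros H.
    apply CV_disk_outside in H. apply H.
    apply ex_series_lim_0. exists 0.
    apply (is_series_ext (V := R_NormedModule)) with (2 := Hb (r / 2) ltac:(lra)).
    intros j. rewrite pow_n_pow. apply Rmult_comm. }
  apply continuity_pt_filterlim in Hc. rewrite PSeries_0 in Hc.
  symmetry.
  apply (filterlim_locally_unique (F := at_right 0) (PSeries b)).
  + apply filterlim_ext_loc with (fun _ => 0); [|apply filterlim_const].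
    exists (mkposreal r Hr). intros y Hy Hy0. symmetry.
    apply is_pseries_unique, Hb. split; [exact Hy0|].
    unfold ball in Hy; simpl in Hy; unfold AbsRing_ball, abs, minus, plus, opp in Hy;
      simpl in Hy. rewrite Ropp_0, Rplus_0_r, Rabs_pos_eq in Hy; lra.
  + eapply filterlim_filter_le_1; [apply filter_le_within | exact Hc].
Qed.

(** Once the constant coefficient vanishes, the series can be divided by its
    variable and the argument repeated. *)
Lemma pseries_zero_right (b : nat -> R) (r : R) :
  0 < r -> (forall y, 0 < y < r -> is_pseries b y 0) -> forall k, b k = 0.
Proof.
  intros Hr Hb k. revert b Hb. induction k as [|k IH]; intros b Hb.
  - exact (pseries_zero_right_0 b r Hr Hb).
  - apply (IH (PS_decr_1 b)). intros y Hy.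
    replace 0 with (scal (/ y) (plus 0 (opp (b O)))).
    + apply (is_pseries_decr_1 (V := R_NormedModule)); [|apply Hb, Hy].
      apply Rinv_l. lra.
    + rewrite (pseries_zero_right_0 b r Hr Hb).
      unfold scal, plus, opp; simpl. unfold mult; simpl. ring.
Qed.

Lemma Cpseries_components (a : nat -> C) (y : R) (l : C) :
  is_pseries (V := C_NormedModule) a (RtoC y) l ->
  is_pseries (fun k => Re (a k)) y (Re l) /\ is_pseries (fun k => Im (a k)) y (Im l).
Proof.
  intros H.
  assert (Hs : forall K, @eq C
    (sum_n (G := C_NormedModule) (fun k => scal (pow_n (K := C_AbsRing) (RtoC y) k) (a k)) K)
    (sum_n (fun k => scal (pow_n y k) (Re (a k))) K,
     sum_n (fun k => scal (pow_n y k) (Im (a k))) K)).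
  { assert (Ht : forall k, @eq C (scal (V := C_NormedModule) (pow_n (K := C_AbsRing) (RtoC y) k) (a k))
        (scal (pow_n y k) (Re (a k)), scal (pow_n y k) (Im (a k)))).
    { intros k. transitivity (RtoC (y ^ k) * a k)%C.
      - rewrite RtoC_pow.
        exact (f_equal (fun u => Cmult u (a k)) (Cpow_n_eq (RtoC y) k)).
      - rewrite <- (pow_n_pow y k). unfold scal; simpl; unfold mult; simpl.
        apply injective_projections; simpl; unfold Re, Im; ring. }
    induction K as [|K IH].
    - rewrite !sum_O. apply Ht.
    - rewrite !sum_Sn.
      etransitivity; [exact (f_equal2 Cplus IH (Ht (S K)))|]. reflexivity. }
  assert (H' : filterlim (fun K : nat => ((sum_n (fun k => scal (pow_n y k) (Re (a k))) K,
     sum_n (fun k => scal (pow_n y k) (Im (a k))) K) : C)) eventually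
     (locally (T := C_UniformSpace) l)).
  { apply (filterlim_ext (F := eventually) _ _ Hs). exact H. }
  split.
  - apply (filterlim_comp _ _ _ _ fst _ _ _ H'). destruct l. apply continuous_fst.
  - apply (filterlim_comp _ _ _ _ snd _ _ _ H'). destruct l. apply continuous_snd.
Qed.

Lemma Cpseries_zero_right (a : nat -> C) (r : R) :
  0 < r ->
  (forall y, 0 < y < r -> is_pseries (V := C_NormedModule) a (RtoC y) (RtoC 0)) ->
  forall k, a k = RtoC 0.
Proof.
  intros Hr Ha k. apply injective_projections; simpl.
  - apply (pseries_zero_right (fun j => Re (a j)) r Hr).
    intros y Hy. apply (Cpseries_components a y (RtoC 0)), Ha, Hy.
  - apply (pseries_zero_right (fun j => Im (a j)) r Hr).
    intros y Hy. apply (Cpseries_components a y (RtoC 0)), Ha, Hy.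
Qed.

Lemma Cpseries_unique (a : nat -> C) (z l1 l2 : C) :
  is_pseries (V := C_NormedModule) a z l1 ->
  is_pseries (V := C_NormedModule) a z l2 -> l1 = l2.
Proof.
  intros H1 H2. exact (filterlim_locally_unique (V := C_NormedModule) _ _ _ H1 H2).
Qed.

(** The local expansions at x agree on a right neighbourhood, hence have the same
    coefficients, hence agree on both sides of x. *)
Lemma analytic_eq_near_right (F G : C -> C) (x e : R) :
  analytic_on slit_plane F -> analytic_on slit_plane G ->
  x <= 0 -> 0 < e ->
  (forall y, 0 < y < e -> F (RtoC (x + y)) = G (RtoC (x + y))) ->
  exists r, 0 < r /\ forall y, - r < y < r -> F (RtoC (x + y)) = G (RtoC (x + y)).
Proof.
  intros HF HG Hx He Heq.
  assert (Hs : slit_plane (RtoC x)).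
  { intros [H _]. simpl in H. lra. }
  destruct (HF _ Hs) as [r1 [a Ha]]. destruct (HG _ Hs) as [r2 [b Hb]].
  set (r := Rmin r1 r2).
  assert (Hr1 : r <= r1) by apply Rmin_l. assert (Hr2 : r <= r2) by apply Rmin_r.
  assert (Hr : 0 < r) by (apply Rmin_pos; [apply cond_pos | apply cond_pos]).
  assert (Hsub : forall y, (RtoC (x + y) - RtoC x)%C = RtoC y).
  { intros y. rewrite RtoC_plus. ring. }
  assert (Hser : forall y, - r < y < r ->
     is_pseries (V := C_NormedModule) a (RtoC y) (F (RtoC (x + y))) /\
     is_pseries (V := C_NormedModule) b (RtoC y) (G (RtoC (x + y)))).
  { intros y Hy.
    assert (Hm : Cmod (RtoC (x + y) - RtoC x) < r).
    { rewrite Hsub, Cmod_R. apply Rabs_def1; lra. }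
    rewrite <- (Hsub y). split; [apply Ha | apply Hb]; lra. }
  assert (Hab : forall k, a k = b k).
  { intros k.
    assert (Hz : PS_minus (V := C_NormedModule) a b k = RtoC 0).
    { apply (Cpseries_zero_right _ (Rmin e r)); [apply Rmin_pos; assumption|].
      intros y Hy.
      assert (He' := Rmin_l e r). assert (Hr' := Rmin_r e r).
      destruct (Hser y ltac:(lra)) as [H1 H2].
      assert (H3 := is_pseries_minus (V := C_NormedModule) _ _ _ _ _ H1 H2).
      rewrite Heq in H3 by lra.
      replace (RtoC 0) with (plus (G (RtoC (x + y))) (opp (G (RtoC (x + y)))))
        by apply (plus_opp_r (G := C_AbelianGroup)).
      exact H3. }
    replace (a k) with (b k + (a k - b k))%C by ring.
    change (a k - b k)%C with (PS_minus (V := C_NormedModule) a b k).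
    rewrite Hz. ring. }
  exists r. split; [exact Hr|]. intros y Hy.
  destruct (Hser y Hy) as [H1 H2].
  apply (Cpseries_unique b (RtoC y)); [|exact H2].
  apply (is_series_ext (V := C_NormedModule)) with (2 := H1).
  intros k. rewrite Hab. reflexivity.
Qed.

(** The identity theorem along the negative real axis. Equality on [-s, 0] passes
    to a larger interval, so the supremum of the admissible s in [0, L] is L. *)
Lemma analytic_unique_neg (F G : C -> C) :
  analytic_on slit_plane F -> analytic_on slit_plane G ->
  (forall z, Cmod z < 1 -> F z = G z) ->
  forall x, 0 <= x -> F (RtoC (- x)) = G (RtoC (- x)).
Proof.
  intros HF HG Hdisk L HL.
  set (S := fun s => 0 <= s <= L /\ forall y, 0 <= y <= s -> F (RtoC (- y)) = G (RtoC (- y))).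
  assert (Hsmall : forall y, 0 <= y <= 1 / 2 -> F (RtoC (- y)) = G (RtoC (- y))).
  { intros y Hy. apply Hdisk. rewrite Cmod_R, Rabs_Ropp, Rabs_pos_eq; lra. }
  destruct (Rle_dec L (1 / 2)) as [HL2|HL2]; [apply Hsmall; lra|].
  assert (HS : S (1 / 2)) by (split; [lra | exact Hsmall]).
  destruct (completeness S) as [s [Hub Hlub]].
  { exists L. intros y [Hy _]. lra. }
  { exists (1 / 2). exact HS. }
  assert (Hs1 : 1 / 2 <= s) by (apply Hub, HS).
  assert (HsL : s <= L) by (apply Hlub; intros y [Hy _]; lra).
  assert (Hlt : forall y, 0 <= y < s -> F (RtoC (- y)) = G (RtoC (- y))).
  { intros y Hy. destruct (classic (exists u, S u /\ y < u)) as [[u [[_ Hu] Hyu]]|Hn].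
    - apply Hu. lra.
    - exfalso. assert (s <= y); [|lra].
      apply Hlub. intros u Hu. apply Rnot_lt_le. intros Hyu. apply Hn. exists u. tauto. }
  destruct (analytic_eq_near_right F G (- s) s HF HG ltac:(lra) ltac:(lra)) as [r [Hr Hext]].
  { intros y Hy. replace (- s + y) with (- (s - y)) by ring. apply Hlt. lra. }
  assert (Hall : forall y, 0 <= y < s + r -> F (RtoC (- y)) = G (RtoC (- y))).
  { intros y Hy. destruct (Rlt_le_dec y s) as [H|H]; [apply Hlt; lra|].
    replace (- y) with (- s + (s - y)) by ring. apply Hext. lra. }
  apply Hall. split; [exact HL|].
  assert (HT : S (Rmin L (s + r / 2))).
  { assert (H1 := Rmin_l L (s + r / 2)). assert (H2 := Rmin_r L (s + r / 2)).
    split; [split; [apply Rmin_glb; lra | exact H1]|].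
    intros y Hy. apply Hall. lra. }
  apply Hub in HT. unfold Rmin in HT. destruct (Rle_dec L (s + r / 2)); lra.
Qed.

(** The integral witnesses the existence of the continuation, so the chosen
    function is one; by uniqueness the two agree at -x. *)
Lemma hyp2F1_half_neg (n : nat) (x : R) :
  0 <= x ->
  hyp2F1 (RtoC (1 / 2)) (RtoC (INR n)) (RtoC (3 / 2)) (RtoC (- x)) =
  euler_int n (RtoC (- x)).
Proof.
  intros Hx.
  assert (HE := euler_int_hyp2F1 n).
  assert (HF : is_hyp2F1 (RtoC (1 / 2)) (RtoC (INR n)) (RtoC (3 / 2))
                 (hyp2F1 (RtoC (1 / 2)) (RtoC (INR n)) (RtoC (3 / 2)))).
  { unfold hyp2F1. apply epsilon_spec. exists (euler_int n). exact HE. }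
  destruct HE as [HE1 HE2], HF as [HF1 HF2].
  apply analytic_unique_neg; try assumption.
  intros z Hz. eapply Cpseries_unique; [apply HF2, Hz | apply HE2, Hz].
Qed.

Lemma euler_int_real (n : nat) (w : R) :
  euler_int n (RtoC (- w ^ 2)) = RtoC (RInt (fun t => / (1 + (w * t) ^ 2) ^ n) 0 1).
Proof.
  apply (is_RInt_unique (V := C_R_CompleteNormedModule)).
  apply (is_RInt_ext (V := C_R_NormedModule) (fun t => RtoC (/ (1 + (w * t) ^ 2) ^ n))).
  - intros t _. refine (_ : @eq C _ _). unfold euler_kernel.
    assert (0 < (1 + (w * t) ^ 2) ^ n) by (apply pow_lt; nra).
    rewrite RtoC_inv, RtoC_pow by lra.
    replace (RtoC (1 + (w * t) ^ 2)) with (1 - RtoC (- w ^ 2) * RtoC (t * t))%C;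
      [reflexivity|].
    rewrite <- RtoC_mult, <- RtoC_minus. f_equal. ring.
  - apply is_CRInt_RtoC, (RInt_correct (V := R_CompleteNormedModule)).
    apply (ex_RInt_continuous (V := R_CompleteNormedModule)). intros t _.
    apply (ex_derive_continuous (V := R_NormedModule)).
    assert (0 < (1 + (w * t) ^ 2) ^ n) by (apply pow_lt; nra).
    auto_derive. simpl in *. lra.
Qed.

(** * Gamma at integers and half-integers *)

(** Value and convergence of Euler's integral together, so that the functional
    equation transports both. *)
Definition is_Gamma (s l : R) : Prop :=
  is_RInt_gen (fun u => Rpower u (s - 1) * exp (- u))
    (at_right 0) (Rbar_locally p_infty) l.

Lemma is_Gamma_unique (s l : R) : is_Gamma s l -> Gamma s = l.
Proof.
  intros H. unfold Gamma.
  apply (@is_RInt_gen_unique R_CompleteNormedModule (at_right 0)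
    (Rbar_locally p_infty) (Proper_StrongProper _ _) (Proper_StrongProper _ _) _ l H).
Qed.

(** The fundamental theorem of calculus on the open half-line (0, +oo). *)
Lemma is_RInt_gen_antiderivative (F f : R -> R) (la lb : R) :
  (forall u, 0 < u -> is_derive F u (f u)) ->
  (forall u, 0 < u -> continuous f u) ->
  filterlim F (at_right 0) (locally la) ->
  is_lim F p_infty lb ->
  is_RInt_gen f (at_right 0) (Rbar_locally p_infty) (lb - la).
Proof.
  intros HF Hf Ha Hb.
  assert (Hpos : filter_prod (at_right 0) (Rbar_locally p_infty) (fun ab : R * R =>
    forall x, Rmin (fst ab) (snd ab) <= x <= Rmax (fst ab) (snd ab) -> 0 < x)).
  { apply Filter_prod with (fun a => 0 < a) (fun b => 0 < b).
    - exists (mkposreal 1 Rlt_0_1). intros y _ Hy. exact Hy.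
    - exists 0. intros y Hy. exact Hy.
    - intros a b Ha0 Hb0 x [Hx _]. simpl in Hx.
      apply Rlt_le_trans with (2 := Hx). apply Rmin_pos; assumption. }
  apply (is_RInt_gen_ext (V := R_NormedModule) (Derive F)).
  - generalize Hpos. apply filter_imp. intros ab H x Hx.
    apply is_derive_unique, HF, H. lra.
  - apply is_RInt_gen_Derive; try exact Ha; try exact Hb.
    + generalize Hpos. apply filter_imp. intros ab H x Hx.
      exists (f x). apply HF, H, Hx.
    + generalize Hpos. apply filter_imp. intros ab H x Hx.
      specialize (H x Hx).
      apply (continuous_ext_loc _ f); [|apply Hf, H].
      exists (mkposreal x H). intros y Hy. symmetry. apply is_derive_unique, HF.
      unfold ball in Hy; simpl in Hy; unfold AbsRing_ball, abs, minus, plus, opp in Hy;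
        simpl in Hy. apply Rabs_def2 in Hy. lra.
Qed.

Lemma Rpower_exp_continuous (s u : R) :
  0 < u -> continuous (fun u => Rpower u s * exp (- u)) u.
Proof.
  intros Hu. apply (ex_derive_continuous (V := R_NormedModule)).
  unfold Rpower. auto_derive. exact Hu.
Qed.

Lemma is_lim_exp_neg : is_lim (fun u => exp (- u)) p_infty 0.
Proof.
  apply (is_lim_comp exp Ropp p_infty 0 m_infty).
  - apply is_lim_exp_m.
  - apply (is_lim_opp (fun u => u) p_infty p_infty), is_lim_id.
  - exists 0. intros; discriminate.
Qed.

Lemma is_Gamma_1 : is_Gamma 1 1.
Proof.
  replace (is_Gamma 1 1) with (is_Gamma 1 (0 - - (1))) by (f_equal; ring).
  unfold is_Gamma.
  apply (is_RInt_gen_antiderivative (fun u => - exp (- u))).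
  - intros u Hu. replace (1 - 1) with 0 by ring. rewrite Rpower_O by exact Hu.
    auto_derive; [exact I|ring].
  - intros u Hu. apply Rpower_exp_continuous, Hu.
  - apply (filterlim_filter_le_1 (F := locally 0)); [apply filter_le_within|].
    replace (- (1)) with (- exp (- 0)) by (rewrite Ropp_0, exp_0; ring).
    apply (ex_derive_continuous (V := R_NormedModule) (fun u => - exp (- u)) 0).
    auto_derive. exact I.
  - replace (Finite 0) with (Rbar_opp 0) by (simpl; f_equal; ring).
    apply is_lim_opp, is_lim_exp_neg.
Qed.

Lemma Rpower_exp_lim_0 (s : R) :
  0 < s -> filterlim (fun u => - (Rpower u s * exp (- u))) (at_right 0) (locally 0).
Proof.
  intros Hs.
  replace 0 with (- (0 * exp (- 0))) at 2 by ring.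
  apply (filterlim_comp _ _ _ (fun u => Rpower u s * exp (- u)) Ropp _ (locally (0 * exp (- 0))));
    [|apply (continuous_opp (V := R_NormedModule) (fun x => x)), continuous_id].
  apply (filterlim_comp_2 (F := at_right 0) (G := locally 0) (H := locally (exp (- 0)))).
  - apply (filterlim_comp _ _ _ (fun u => s * ln u) exp _ (Rbar_locally m_infty)).
    + apply (filterlim_comp _ _ _ ln (fun y => s * y) _ (Rbar_locally m_infty)).
      * apply is_lim_ln_0.
      * assert (H := is_lim_scal_l (fun y => y) s m_infty m_infty (is_lim_id _)).
        unfold is_lim, Rbar_locally' in H.
        replace (Rbar_mult s m_infty) with m_infty in H; [exact H|].
        symmetry. apply is_Rbar_mult_unique, is_Rbar_mult_sym.
        apply is_Rbar_mult_m_infty_pos, Hs.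
    + apply is_lim_exp_m.
  - apply (filterlim_filter_le_1 (F := locally 0)); [apply filter_le_within|].
    apply (ex_derive_continuous (V := R_NormedModule) (fun u => exp (- u)) 0).
    auto_derive. exact I.
  - apply (filterlim_mult (K := R_AbsRing) 0 (exp (- 0))).
Qed.

Lemma Rpower_exp_lim_infty (s : R) :
  is_lim (fun u => - (Rpower u s * exp (- u))) p_infty 0.
Proof.
  replace (Finite 0) with (Rbar_opp 0) by (simpl; f_equal; ring).
  apply is_lim_opp.
  apply is_lim_ext_loc with (fun u => exp (u * (s * (ln u / u) - 1))).
  { exists 0. intros u Hu. unfold Rpower. rewrite <- exp_plus. f_equal. field. lra. }
  apply (is_lim_comp exp _ p_infty 0 m_infty).
  - apply is_lim_exp_m.
  - replace m_infty with (Rbar_mult p_infty (-1)).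
    2:{ apply is_Rbar_mult_unique, is_Rbar_mult_p_infty_neg. simpl. lra. }
    apply (is_lim_mult (fun u => u) (fun u => s * (ln u / u) - 1) p_infty p_infty (-1)).
    + apply is_lim_id.
    + replace (Finite (-1)) with (Finite (s * 0 - 1)) by (f_equal; ring).
      apply is_lim_minus'; [|apply is_lim_const].
      apply (is_lim_scal_l _ s p_infty 0), is_lim_div_ln_p.
    + simpl. lra.
  - exists 0. intros; discriminate.
Qed.

(** Integration by parts: u^s e^(-u) is s u^(s-1) e^(-u) minus the derivative of
    u^s e^(-u), whose limits at 0 and +oo vanish. *)
Lemma is_Gamma_succ (s l : R) : 0 < s -> is_Gamma s l -> is_Gamma (s + 1) (s * l).
Proof.
  intros Hs Hl. unfold is_Gamma.
  replace (s * l) with (plus (scal s l) (0 - 0))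
    by (unfold plus, scal; simpl; unfold mult; simpl; ring).
  assert (H : is_RInt_gen
    (fun u => - (s * Rpower u (s - 1) * exp (- u)) + Rpower u s * exp (- u))
    (at_right 0) (Rbar_locally p_infty) (0 - 0)).
  { apply (is_RInt_gen_antiderivative (fun u => - (Rpower u s * exp (- u)))).
    - intros u Hu. unfold Rpower. auto_derive; [exact Hu|].
      replace ((s - 1) * ln u) with (s * ln u + - ln u) by ring.
      rewrite exp_plus, (exp_Ropp (ln u)), exp_ln by exact Hu. field. lra.
    - intros u Hu. apply (ex_derive_continuous (V := R_NormedModule)).
      unfold Rpower. auto_derive. auto.
    - apply Rpower_exp_lim_0, Hs.
    - apply Rpower_exp_lim_infty. }
  apply (is_RInt_gen_ext (V := R_NormedModule)) with
    (2 := is_RInt_gen_plus (V := R_NormedModule) _ _ _ _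
            (is_RInt_gen_scal (V := R_NormedModule) _ s _ Hl) H).
  apply filter_forall. intros ab x _.
  unfold plus, scal; simpl; unfold mult; simpl.
  replace (s + 1 - 1) with s by ring. ring.
Qed.

Definition gauss (x : R) : R := RInt (fun s => exp (- s ^ 2)) 0 x.

Lemma gauss_derive (x : R) : is_derive gauss x (exp (- x ^ 2)).
Proof.
  assert (Hc : forall y, continuous (fun s => exp (- s ^ 2)) y).
  { intros y. apply (ex_derive_continuous (V := R_NormedModule)). auto_derive. exact I. }
  apply (is_derive_RInt (V := R_NormedModule) (fun s => exp (- s ^ 2)) gauss 0 x).
  - apply filter_forall. intros y.
    apply (RInt_correct (V := R_CompleteNormedModule)).
    apply (ex_RInt_continuous (V := R_CompleteNormedModule)). intros z _. apply Hc.
  - apply Hc.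
Qed.

(** The companion of the Gaussian integral in the classical proof by
    differentiation under the integral sign: the sum of gauss^2 and of this
    function has derivative zero. *)
Definition gauss_aux (x : R) : R :=
  RInt (fun t => exp (- (x ^ 2 * (1 + t ^ 2))) / (1 + t ^ 2)) 0 1.

Lemma gauss_aux_ex (x : R) :
  ex_RInt (fun t => exp (- (x ^ 2 * (1 + t ^ 2))) / (1 + t ^ 2)) 0 1.
Proof.
  apply (ex_RInt_continuous (V := R_CompleteNormedModule)). intros t _.
  apply (ex_derive_continuous (V := R_NormedModule)). auto_derive. nra.
Qed.

(** Differentiating in x cancels the denominator 1 + t^2; the substitution
    s = x t then turns the remaining integral over t into gauss x. *)
Lemma gauss_aux_derive (x : R) :
  is_derive gauss_aux x (- 2 * exp (- x ^ 2) * gauss x).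
Proof.
  assert (HD : forall y t, is_derive (fun u => exp (- (u ^ 2 * (1 + t ^ 2))) / (1 + t ^ 2)) y
                 (- 2 * y * exp (- (y ^ 2 * (1 + t ^ 2))))).
  { intros y t. assert (Ht : 1 + t ^ 2 <> 0) by nra.
    auto_derive; [exact I|]. simpl. field. nra. }
  assert (H := is_derive_RInt_param
    (fun u t => exp (- (u ^ 2 * (1 + t ^ 2))) / (1 + t ^ 2)) 0 1 x).
  replace (- 2 * exp (- x ^ 2) * gauss x) with
    (RInt (fun t => Derive (fun u => exp (- (u ^ 2 * (1 + t ^ 2))) / (1 + t ^ 2)) x) 0 1).
  - apply H.
    + apply filter_forall. intros y t _. eexists. apply HD.
    + intros t _.
      apply (continuity_2d_pt_ext (fun u v => - 2 * u * exp (- (u ^ 2 * (1 + v ^ 2))))).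
      { intros u v. symmetry. apply is_derive_unique, HD. }
      repeat first
        [ apply continuity_2d_pt_mult | apply continuity_2d_pt_plus
        | apply continuity_2d_pt_opp | apply continuity_2d_pt_const
        | apply continuity_2d_pt_id1 | apply continuity_2d_pt_id2
        | apply (continuity_1d_2d_pt_comp exp); [apply derivable_continuous, derivable_exp|] ].
    + apply filter_forall. intros y. apply gauss_aux_ex.
  - rewrite (RInt_ext _ (fun t => (-2 * exp (- x ^ 2)) * (x * exp (- (x * t + 0) ^ 2)))).
    + assert (Hex : ex_RInt (fun s => exp (- s ^ 2)) (x * 0 + 0) (x * 1 + 0)).
      { apply (ex_RInt_continuous (V := R_CompleteNormedModule)). intros z _.
        apply (ex_derive_continuous (V := R_NormedModule)). auto_derive. exact I. }
      assert (Hlin := is_RInt_comp_lin (V := R_NormedModule) _ x 0 0 1 _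
                        (RInt_correct (V := R_CompleteNormedModule) _ _ _ Hex)).
      assert (Hs := is_RInt_scal (V := R_NormedModule) _ _ _ (-2 * exp (- x ^ 2)) _ Hlin).
      apply (is_RInt_unique (V := R_CompleteNormedModule)) in Hs.
      replace (x * 0 + 0) with 0 in Hs by ring. replace (x * 1 + 0) with x in Hs by ring.
      exact Hs.
    + intros t _. etransitivity; [exact (is_derive_unique _ _ _ (HD x t))|].
      replace (- (x ^ 2 * (1 + t ^ 2))) with (- x ^ 2 + - (x * t + 0) ^ 2) by ring.
      rewrite exp_plus. refine (_ : @eq R _ _). ring.
Qed.

(** The constant is the value at x = 0, the integral of 1 / (1 + t^2) over
    [0, 1]. *)
Lemma gauss_sq (x : R) : 0 <= x -> gauss x ^ 2 = PI / 4 - gauss_aux x.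
Proof.
  intros Hx.
  assert (H0 : gauss 0 ^ 2 + gauss_aux 0 = PI / 4).
  { unfold gauss. rewrite (RInt_point (V := R_CompleteNormedModule)).
    unfold gauss_aux.
    rewrite (is_RInt_unique _ _ _ (atan 1 - atan 0)).
    - rewrite atan_1, atan_0. change zero with 0. ring.
    - apply (is_RInt_ext (V := R_NormedModule) (fun t => / (1 + t ^ 2))).
      + intros t _. replace (- (0 ^ 2 * (1 + t ^ 2))) with 0 by ring.
        rewrite exp_0. unfold Rdiv. simpl. ring.
      + apply (is_RInt_derive (V := R_CompleteNormedModule) atan).
        * intros t _. auto_derive; [exact I|]. unfold Rsqr. simpl. field. nra.
        * intros t _. apply (ex_derive_continuous (V := R_NormedModule)).
          auto_derive. nra. }
  assert (HD : forall y, is_derive (fun y => gauss y ^ 2 + gauss_aux y) y 0).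
  { intros y.
    replace 0 with (plus (2 * gauss y * exp (- y ^ 2)) (- 2 * exp (- y ^ 2) * gauss y))
      by (unfold plus; simpl; ring).
    apply (is_derive_plus (V := R_NormedModule)); [|apply gauss_aux_derive].
    assert (Hg := gauss_derive y). auto_derive; [eexists; exact Hg|].
    change (Derive (fun y => gauss y) y) with (Derive gauss y).
    rewrite (is_derive_unique _ _ _ Hg). simpl. ring. }
  destruct (Rle_lt_or_eq_dec 0 x Hx) as [Hlt|<-]; [|lra].
  destruct (MVT_gen (fun y => gauss y ^ 2 + gauss_aux y) 0 x (fun _ => 0)) as [c [_ Hc]].
  - intros y _. exact (HD y).
  - intros y _. apply continuity_pt_filterlim.
    apply (ex_derive_continuous (V := R_NormedModule) (fun y => gauss y ^ 2 + gauss_aux y)).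
    exists 0. exact (HD y).
  - lra.
Qed.

Lemma gauss_lim : is_lim gauss p_infty (sqrt PI / 2).
Proof.
  assert (Haux : is_lim gauss_aux p_infty 0).
  { apply (is_lim_le_le_loc (fun _ => 0) (fun x => exp (- x))).
    - exists 1. intros x Hx.
      assert (Hb : forall t, 0 <= t <= 1 ->
        0 <= exp (- (x ^ 2 * (1 + t ^ 2))) / (1 + t ^ 2) <= exp (- x)).
      { intros t Ht. assert (H1 := exp_pos (- (x ^ 2 * (1 + t ^ 2)))).
        assert (H2 : 1 <= 1 + t ^ 2) by nra.
        split.
        - apply Rlt_le, Rdiv_lt_0_compat; lra.
        - apply Rle_trans with (exp (- (x ^ 2 * (1 + t ^ 2)))).
          + apply Rmult_le_reg_r with (1 + t ^ 2); [lra|].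
            unfold Rdiv. rewrite Rmult_assoc, Rinv_l by lra. nra.
          + destruct (Rle_lt_or_eq_dec (- (x ^ 2 * (1 + t ^ 2))) (- x)) as [H|H]; [nra| |].
            * left. apply exp_increasing, H.
            * right. f_equal. exact H. }
      split.
      + apply RInt_ge_0; [lra | apply gauss_aux_ex|]. intros t Ht. apply Hb. lra.
      + replace (exp (- x)) with (RInt (fun _ => exp (- x)) 0 1).
        * apply RInt_le; [lra | apply gauss_aux_ex | apply ex_RInt_const|].
          intros t Ht. apply Hb. lra.
        * rewrite RInt_const. unfold scal; simpl; unfold mult; simpl. ring.
    - apply is_lim_const.
    - apply is_lim_exp_neg. }
  replace (sqrt PI / 2) with (sqrt (PI / 4 - 0)).
  - apply is_lim_ext_loc with (fun x => sqrt (PI / 4 - gauss_aux x)).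
    + exists 0. intros x Hx. rewrite <- gauss_sq by lra. apply sqrt_pow2.
      apply RInt_ge_0; [lra| |].
      * apply (ex_RInt_continuous (V := R_CompleteNormedModule)). intros z _.
        apply (ex_derive_continuous (V := R_NormedModule)). auto_derive. exact I.
      * intros y _. apply Rlt_le, exp_pos.
    + apply (is_lim_comp_continuous (fun x => PI / 4 - gauss_aux x) sqrt p_infty (PI / 4 - 0)).
      * apply is_lim_minus'; [apply is_lim_const | exact Haux].
      * apply continuous_sqrt.
  - replace (PI / 4 - 0) with (PI / 2 ^ 2) by (simpl; field).
    assert (HPI := PI_RGT_0).
    rewrite sqrt_div_alt by (simpl; lra). rewrite sqrt_pow2 by lra. reflexivity.
Qed.

(** The substitution u = s^2 reduces Gamma(1/2) to the Gaussian integral. *)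
Lemma is_Gamma_half : is_Gamma (1 / 2) (sqrt PI).
Proof.
  unfold is_Gamma. replace (sqrt PI) with (2 * (sqrt PI / 2) - 0) by field.
  apply (is_RInt_gen_antiderivative (fun u => 2 * gauss (sqrt u))).
  - intros u Hu. assert (Hsq := sqrt_lt_R0 u Hu).
    assert (Hg := gauss_derive (sqrt u)).
    auto_derive; [split; [eexists; exact Hg | split; [exact Hu | exact I]]|].
    change (Derive (fun y => gauss y) (sqrt u)) with (Derive gauss (sqrt u)).
    rewrite (is_derive_unique _ _ _ Hg).
    replace (1 / 2 - 1) with (- (/ 2)) by field.
    rewrite Rpower_Ropp, Rpower_sqrt by exact Hu.
    rewrite pow2_sqrt by lra. field. lra.
  - intros u Hu. apply Rpower_exp_continuous, Hu.
  - apply (filterlim_filter_le_1 (F := locally 0)); [apply filter_le_within|].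
    replace 0 with (2 * gauss (sqrt 0)) at 2.
    + apply (continuous_scal_r (V := R_NormedModule) 2 (fun u => gauss (sqrt u)) 0).
      apply continuous_comp; [apply continuous_sqrt|].
      apply (ex_derive_continuous (V := R_NormedModule)). eexists. apply gauss_derive.
    + rewrite sqrt_0. unfold gauss. rewrite (RInt_point (V := R_CompleteNormedModule)).
      change zero with 0. ring.
  - apply (is_lim_scal_l _ 2 p_infty (sqrt PI / 2)).
    apply (is_lim_comp gauss sqrt p_infty (sqrt PI / 2) p_infty).
    + apply gauss_lim.
    + apply filterlim_sqrt_p.
    + exists 0. intros; discriminate.
Qed.

(** * The integral of (1 + y^2)^(-n) and its tail *)

(** The integral of (1 + y^2)^(-(p+1)) over [0, +oo), by its reduction formula. *)
Fixpoint wallis (p : nat) : R :=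
  match p with
  | O => PI / 2
  | S q => (2 * INR q + 1) / (2 * INR q + 2) * wallis q
  end.

(** Both sides satisfy the same recurrence in p, by the functional equation of
    Gamma; the case p = 0 is Gamma(1/2)^2 = PI. *)
Lemma Gamma_ratio (p : nat) :
  exists a b, is_Gamma (INR p + 1 / 2) a /\ is_Gamma (INR p + 1) b /\
    0 < b /\ sqrt PI / 2 * a = wallis p * b.
Proof.
  assert (HPI := PI_RGT_0).
  induction p as [|p (a & b & Ha & Hb & Hpos & Hab)].
  - exists (sqrt PI), 1. simpl INR. rewrite !Rplus_0_l.
    split; [apply is_Gamma_half|]. split; [apply is_Gamma_1|]. split; [lra|].
    simpl. assert (H := sqrt_sqrt PI (Rlt_le _ _ HPI)). lra.
  - assert (Hp := pos_INR p).
    exists ((INR p + 1 / 2) * a), ((INR p + 1) * b). rewrite S_INR. repeat split.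
    + replace (INR p + 1 + 1 / 2) with (INR p + 1 / 2 + 1) by ring.
      apply is_Gamma_succ; [lra | exact Ha].
    + apply is_Gamma_succ; [lra | exact Hb].
    + nra.
    + replace (sqrt PI / 2 * ((INR p + 1 / 2) * a))
        with ((INR p + 1 / 2) * (sqrt PI / 2 * a)) by ring.
      rewrite Hab. simpl wallis. field. lra.
Qed.

Lemma Gamma_quotient (p : nat) :
  Gamma (3 / 2) * Gamma (INR p + 1 / 2) / Gamma (INR p + 1) = wallis p.
Proof.
  destruct (Gamma_ratio p) as (a & b & Ha & Hb & Hpos & Hab).
  assert (H := is_Gamma_succ (1 / 2) _ ltac:(lra) is_Gamma_half).
  replace (1 / 2 + 1) with (3 / 2) in H by field.
  rewrite (is_Gamma_unique _ _ H), (is_Gamma_unique _ _ Ha), (is_Gamma_unique _ _ Hb).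
  replace (1 / 2 * sqrt PI * a) with (sqrt PI / 2 * a) by field.
  rewrite Hab. field. lra.
Qed.

(** The integral of (1 + y^2)^(-(p+1)) over [0, w], in the closed form that the
    reduction formula gives. *)
Fixpoint wallis_upto (p : nat) (w : R) : R :=
  match p with
  | O => atan w
  | S q => (2 * INR q + 1) / (2 * INR q + 2) * wallis_upto q w
           + w / ((2 * INR q + 2) * (1 + w ^ 2) ^ S q)
  end.

Lemma one_plus_sq_pow_pos (w : R) (n : nat) : 0 < (1 + w ^ 2) ^ n.
Proof. apply pow_lt. nra. Qed.

Lemma wallis_upto_derive (p : nat) (w : R) : is_derive (wallis_upto p) w (/ (1 + w ^ 2) ^ S p).
Proof.
  induction p as [|p IH].
  - simpl wallis_upto. auto_derive; [exact I|]. unfold Rsqr. simpl. field. nra.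
  - assert (Hp := pos_INR p).
    assert (H1 := one_plus_sq_pow_pos w p).
    assert (H2 : is_derive (fun w => w / ((2 * INR p + 2) * (1 + w ^ 2) ^ S p)) w
      (/ ((2 * INR p + 2) * (1 + w ^ 2) ^ S p) - w ^ 2 / (1 + w ^ 2) ^ S (S p))).
    { auto_derive.
      - apply Rmult_integral_contrapositive_currified; [lra|].
        change (1 + w * (w * 1)) with (1 + w ^ 2).
        change ((1 + w ^ 2) ^ S p <> 0).
        generalize (one_plus_sq_pow_pos w (S p)). lra.
      - change (w * (w * 1)) with (w ^ 2).
        change (match p with O => 1 | S _ => INR p + 1 end) with (INR (S p)).
        rewrite S_INR. simpl Init.Nat.pred. rewrite <- !tech_pow_Rmult.
        field. split; [exact (Rgt_not_eq _ _ H1) | split; [nra|lra]]. }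
    replace (/ (1 + w ^ 2) ^ S (S p)) with
      (plus ((2 * INR p + 1) / (2 * INR p + 2) * / (1 + w ^ 2) ^ S p)
        (/ ((2 * INR p + 2) * (1 + w ^ 2) ^ S p) - w ^ 2 / (1 + w ^ 2) ^ S (S p))).
    + apply (is_derive_plus (V := R_NormedModule)); [|exact H2].
      apply (is_derive_scal (wallis_upto p)). exact IH.
    + unfold plus; simpl. field.
      split; [exact (Rgt_not_eq _ _ H1) | split; [nra|lra]].
Qed.

Lemma wallis_upto_0 (p : nat) : wallis_upto p 0 = 0.
Proof.
  induction p as [|p IH]; [apply atan_0|].
  simpl wallis_upto. rewrite IH. unfold Rdiv. ring.
Qed.

(** The factor w comes from the substitution y = w t. *)
Lemma wallis_upto_integral (p : nat) (w : R) :
  w * RInt (fun t => / (1 + (w * t) ^ 2) ^ S p) 0 1 = wallis_upto p w.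
Proof.
  assert (Hc : forall t, continuous (fun t => / (1 + (w * t) ^ 2) ^ S p) t).
  { intros t. apply (ex_derive_continuous (V := R_NormedModule)).
    assert (H := one_plus_sq_pow_pos (w * t) (S p)).
    auto_derive. simpl in *. lra. }
  assert (H : is_RInt (fun t => w * / (1 + (w * t) ^ 2) ^ S p) 0 1
                (wallis_upto p (w * 1) - wallis_upto p (w * 0))).
  { apply (is_RInt_derive (V := R_CompleteNormedModule) (fun t => wallis_upto p (w * t))).
    - intros t _.
      apply (is_derive_comp (V := R_NormedModule) (wallis_upto p) (fun t => w * t)).
      + apply wallis_upto_derive.
      + auto_derive; [exact I | ring].
    - intros t _. apply (continuous_scal_r (V := R_NormedModule) w), Hc. }
  rewrite Rmult_0_r, Rmult_1_r, wallis_upto_0, Rminus_0_r in H.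
  rewrite <- (is_RInt_unique _ _ _ _ H). symmetry.
  apply (RInt_scal (V := R_CompleteNormedModule)).
  apply (ex_RInt_continuous (V := R_CompleteNormedModule)). intros t _. apply Hc.
Qed.

Lemma is_lim_inv_pow (k : nat) : is_lim (fun w => (/ w) ^ S k) p_infty 0.
Proof.
  replace (Finite 0) with (Finite (0 ^ S k)) by (f_equal; apply pow_i; lia).
  apply (is_lim_comp_continuous Rinv (fun v => v ^ S k) p_infty 0).
  - replace (Finite 0) with (Rbar_inv p_infty) by reflexivity.
    apply (is_lim_inv (fun w => w)); [apply is_lim_id | discriminate].
  - apply (ex_derive_continuous (V := R_NormedModule)). auto_derive. exact I.
Qed.

Lemma wallis_upto_lim (p : nat) : is_lim (wallis_upto p) p_infty (wallis p).
Proof.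
  induction p as [|p IH].
  - simpl. apply is_lim_ext_loc with (fun w => PI / 2 - atan ((/ w) ^ 1)).
    + exists 0. intros w Hw. rewrite pow_1, atan_inv by exact Hw. simpl. ring.
    + replace (Finite (PI / 2)) with (Finite (PI / 2 - atan 0))
        by (rewrite atan_0; f_equal; ring).
      apply is_lim_minus'; [apply is_lim_const|].
      apply (is_lim_comp_continuous (fun w => (/ w) ^ 1) atan p_infty 0); [apply is_lim_inv_pow|].
      apply (ex_derive_continuous (V := R_NormedModule)). auto_derive. exact I.
  - assert (Hp := pos_INR p). simpl wallis_upto. simpl wallis.
    replace (Finite ((2 * INR p + 1) / (2 * INR p + 2) * wallis p))
      with (Finite ((2 * INR p + 1) / (2 * INR p + 2) * wallis p + 0)) by (f_equal; ring).
    apply is_lim_plus'.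
    + apply (is_lim_scal_l (wallis_upto p) _ p_infty (wallis p)), IH.
    + apply (is_lim_le_le_loc (fun _ => 0) (fun w => (/ w) ^ 1)).
      * exists 1. intros w Hw. rewrite pow_1.
        change ((1 + w * (w * 1)) * (1 + w * (w * 1)) ^ p) with ((1 + w ^ 2) ^ S p).
        assert (H1 : 1 + w ^ 2 <= (1 + w ^ 2) ^ S p).
        { rewrite <- (pow_1 (1 + w ^ 2)) at 1. apply Rle_pow; [nra | lia]. }
        assert (H2 : w ^ 2 <= (2 * INR p + 2) * (1 + w ^ 2) ^ S p) by nra.
        assert (Hw2 : 0 < w ^ 2) by nra.
        split.
        -- apply Rlt_le, Rdiv_lt_0_compat; lra.
        -- replace (/ w) with (w / w ^ 2) by (field; lra).
           apply Rmult_le_compat_l; [lra|]. apply Rinv_le_contravar; lra.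
      * apply is_lim_const.
      * apply is_lim_inv_pow.
Qed.

Lemma lim_decreasing_ge (f df : R -> R) (w0 l : R) :
  (forall w, w0 <= w -> is_derive f w (df w)) ->
  (forall w, w0 <= w -> df w <= 0) ->
  is_lim f p_infty l -> l <= f w0.
Proof.
  intros Hd Hneg Hlim.
  apply (is_lim_le_loc f (fun _ => f w0) p_infty l (f w0)); [|exact Hlim|apply is_lim_const].
  exists w0. intros w Hw.
  destruct (MVT_gen f w0 w df) as [c [Hc E]].
  - intros y Hy. rewrite Rmin_left in Hy by lra. apply Hd. lra.
  - intros y Hy. rewrite Rmin_left in Hy by lra.
    apply continuity_pt_filterlim, (ex_derive_continuous (V := R_NormedModule)).
    exists (df y). apply Hd. lra.
  - rewrite Rmin_left in Hc by lra. specialize (Hneg c ltac:(lra)). nra.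
Qed.

Lemma pow_inv_derive (p : nat) (w : R) :
  0 < w ->
  is_derive (fun w => (/ w) ^ (2 * p + 1) / (2 * INR p + 1)) w (- (/ w ^ 2) ^ S p).
Proof.
  intros Hw. assert (Hp := pos_INR p).
  auto_derive; [lra|].
  replace (Init.Nat.pred (p + (p + 0) + 1)) with (2 * p)%nat by lia.
  replace (INR (p + (p + 0) + 1)) with (2 * INR p + 1)
    by (rewrite !plus_INR; simpl; ring).
  rewrite pow_mult. replace ((/ w) ^ 2) with (/ w ^ 2) by (field; lra).
  change ((/ w ^ 2) ^ S p) with (/ w ^ 2 * (/ w ^ 2) ^ p).
  set (x := (/ w ^ 2) ^ p). field. lra.
Qed.

Lemma pow_inv_lim (p : nat) :
  is_lim (fun w => (/ w) ^ (2 * p + 1) / (2 * INR p + 1)) p_infty 0.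
Proof.
  replace (Finite 0) with (Rbar_mult 0 (/ (2 * INR p + 1))) by (simpl; f_equal; ring).
  apply (is_lim_scal_r (fun w => (/ w) ^ (2 * p + 1))).
  replace (2 * p + 1)%nat with (S (2 * p)) by lia. apply is_lim_inv_pow.
Qed.

(** The integrand is at most y^(-2p-2) on the tail. *)
Lemma wallis_tail_le (p : nat) (w : R) :
  0 < w -> wallis p - wallis_upto p w <= (/ w) ^ (2 * p + 1) / (2 * INR p + 1).
Proof.
  intros Hw.
  assert (H : wallis p + 0 <= wallis_upto p w + (/ w) ^ (2 * p + 1) / (2 * INR p + 1)); [|lra].
  apply (lim_decreasing_ge
    (fun w => wallis_upto p w + (/ w) ^ (2 * p + 1) / (2 * INR p + 1))
    (fun w => / (1 + w ^ 2) ^ S p + - (/ w ^ 2) ^ S p) w).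
  - intros y Hy. apply (is_derive_plus (V := R_NormedModule)).
    + apply wallis_upto_derive.
    + apply pow_inv_derive. lra.
  - intros y Hy. rewrite pow_inv.
    assert (H : / (1 + y ^ 2) ^ S p <= / (y ^ 2) ^ S p); [|lra].
    apply Rinv_le_contravar; [apply pow_lt; nra|].
    apply pow_incr. nra.
  - apply is_lim_plus'; [apply wallis_upto_lim | apply pow_inv_lim].
Qed.

(** For y >= w one has 1 + y^2 <= (1 + w^(-2)) y^2, so on the tail the integrand
    is at least a constant multiple of y^(-2p-2), and the constant tends to 1 as w
    grows. *)
Lemma wallis_tail_ge (p : nat) (w : R) :
  0 < w ->
  / (1 + (/ w) ^ 2) ^ S p * ((/ w) ^ (2 * p + 1) / (2 * INR p + 1)) <= wallis p - wallis_upto p w.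
Proof.
  intros Hw. assert (Hiw := Rinv_0_lt_compat w Hw).
  set (c := / (1 + (/ w) ^ 2) ^ S p).
  assert (H : - wallis p + - c * 0 <=
              - wallis_upto p w + - c * ((/ w) ^ (2 * p + 1) / (2 * INR p + 1))); [|lra].
  apply (lim_decreasing_ge
    (fun w => - wallis_upto p w + - c * ((/ w) ^ (2 * p + 1) / (2 * INR p + 1)))
    (fun w => - / (1 + w ^ 2) ^ S p + - c * - (/ w ^ 2) ^ S p) w).
  - intros y Hy. apply (is_derive_plus (V := R_NormedModule)).
    + apply (is_derive_opp (V := R_NormedModule)), wallis_upto_derive.
    + apply (is_derive_scal (fun w => (/ w) ^ (2 * p + 1) / (2 * INR p + 1))).
      apply pow_inv_derive. lra.
  - intros y Hy.
    assert (H : c * (/ y ^ 2) ^ S p <= / (1 + y ^ 2) ^ S p); [|lra].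
    unfold c.
    rewrite <- (pow_inv (1 + (/ w) ^ 2)), <- (pow_inv (1 + y ^ 2)), <- Rpow_mult_distr.
    (* The inequality 1 + y^2 <= (1 + w^(-2)) y^2 is 1 <= (y / w)^2. *)
    assert (Hvy : 1 <= / w * y).
    { apply Rmult_le_reg_l with w; [lra|]. rewrite <- Rmult_assoc, Rinv_r; lra. }
    rewrite <- Rinv_mult. apply pow_incr. split.
    + apply Rlt_le, Rinv_0_lt_compat. nra.
    + apply Rinv_le_contravar; [nra|].
      replace ((1 + (/ w) ^ 2) * y ^ 2) with (y ^ 2 + (/ w * y) ^ 2) by ring.
      nra.
  - apply is_lim_plus'.
    + apply (is_lim_opp (wallis_upto p) p_infty (wallis p)), wallis_upto_lim.
    + apply (is_lim_scal_l _ (- c) p_infty 0), pow_inv_lim.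
Qed.

(** * The asymptotic equivalence *)

(** The two tail bounds pinch the quotient between 1 and a factor tending to 1. *)
Lemma wallis_tail_equiv (p : nat) (c : R) (w : nat -> R) :
  (forall N, (1 <= N)%nat -> 0 < w N) ->
  is_lim_seq (fun N => / w N) 0 ->
  is_equiv (V := C_NormedModule) eventually
    (fun N => RtoC (c * (wallis p - wallis_upto p (w N))))
    (fun N => RtoC (c * ((/ w N) ^ (2 * p + 1) / (2 * INR p + 1)))).
Proof.
  intros Hw Hlim eps.
  assert (Hc : is_lim_seq (fun N => / (1 + (/ w N) ^ 2) ^ S p) 1).
  { replace (Finite 1) with (Finite (/ (1 + 0 ^ 2) ^ S p)).
    - apply (is_lim_seq_continuous (fun v => / (1 + v ^ 2) ^ S p)); [|exact Hlim].
      apply continuity_pt_filterlim, 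
        (ex_derive_continuous (V := R_NormedModule) (fun v => / (1 + v ^ 2) ^ S p)).
      assert (H := one_plus_sq_pow_pos 0 (S p)). auto_derive. simpl in *. lra.
    - f_equal. replace (1 + 0 ^ 2) with 1 by ring. rewrite pow1. field. }
  apply is_lim_seq_spec in Hc.
  assert (H1 : eventually (fun N => (1 <= N)%nat)) by (exists 1%nat; auto).
  generalize (filter_and _ _ H1 (Hc eps)). apply filter_imp. clear Hc H1.
  intros N [HN Hc]. specialize (Hw N HN).
  assert (Hle := wallis_tail_le p (w N) Hw). assert (Hge := wallis_tail_ge p (w N) Hw).
  set (a := (/ w N) ^ (2 * p + 1) / (2 * INR p + 1)) in *.
  set (T := wallis p - wallis_upto p (w N)) in *.
  set (q := / (1 + (/ w N) ^ 2) ^ S p) in *.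
  change (Cmod (RtoC (c * a) - RtoC (c * T)) <= eps * Cmod (RtoC (c * a))).
  rewrite <- RtoC_minus, !Cmod_R.
  replace (c * a - c * T) with (c * (a - T)) by ring.
  rewrite !Rabs_mult.
  assert (Ha : 0 <= a).
  { unfold a. assert (Hp := pos_INR p). assert (Hi := Rinv_0_lt_compat _ Hw).
    apply Rlt_le, Rdiv_lt_0_compat; [apply pow_lt, Hi | lra]. }
  rewrite (Rabs_pos_eq (a - T)), (Rabs_pos_eq a) by lra.
  apply Rabs_def2 in Hc. assert (Habs := Rabs_pos c).
  assert (a - T <= eps * a) by nra.
  replace (eps * (Rabs c * a)) with (Rabs c * (eps * a)) by ring.
  apply Rmult_le_compat_l; assumption.
Qed.

Theorem mainTheorem3 :
  forall (X : CompleteNormedModule C_AbsRing) (A : operator X)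
    (K : R -> X -> X) (M : R),
    separable X ->
    generates A K ->
    1 <= M ->
    (forall s : R, 0 <= s -> Rbar_le (op_norm (K s)) (Finite M)) ->
    forall (m : nat) (delta h t : R) (x : X),
      (2 <= m)%nat -> Nat.Even m ->
      0 < delta -> 0 < h -> 0 < t ->
      op_dom (op_pow A m) x ->
      forall B : nat -> C,
        (forall N : nat, (1 <= N)%nat ->
          B N =
          (RtoC (M * exp (delta * t) / delta ^ m) *
           (RtoC (Gamma (3 / 2) * Gamma ((INR m - 1) / 2)
                    / (PI * Gamma (INR m / 2)))
            - RtoC (h * INR N / (PI * delta))
              * hyp2F1 (RtoC (1 / 2)) (RtoC (INR m / 2)) (RtoC (3 / 2))
                  (RtoC (- (h * INR N / delta) ^ 2))) *
           RtoC (norm (op_pow (op_shift (RtoC (2 * delta)) A) m x)))%C) ->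
        is_equiv eventually B
          (fun N : nat =>
             RtoC (M * exp (delta * t) / (PI * delta ^ m) *
                   (1 / (INR m - 1) * (delta / (h * INR N)) ^ (m - 1)) *
                   norm (op_pow (op_shift (RtoC (2 * delta)) A) m x))).
Proof.
  intros X A K M _ _ _ _ m delta h t x Hm [q Hq] Hdelta Hh _ _ B HB.
  destruct q as [|p]; [lia|].
  set (nrm := norm (op_pow (op_shift (RtoC (2 * delta)) A) m x)) in *.
  assert (HPI := PI_RGT_0). assert (Hp := pos_INR p).
  assert (Hdm : delta ^ m <> 0) by (apply pow_nonzero; lra).
  assert (HmR : INR m = 2 * (INR p + 1)).
  { rewrite Hq, mult_INR, (S_INR p). simpl (INR 2). ring. }
  set (w := fun N : nat => h * INR N / delta).
  set (c := M * exp (delta * t) / (PI * delta ^ m) * nrm).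
  assert (Hw : forall N, (1 <= N)%nat -> 0 < w N).
  { intros N HN. apply le_INR in HN. simpl in HN.
    unfold w. apply Rdiv_lt_0_compat; nra. }
  assert (Hlim : is_lim_seq (fun N => / w N) 0).
  { apply is_lim_seq_ext_loc with (fun N => delta / h * / INR N).
    - exists 1%nat. intros N HN. apply le_INR in HN. simpl in HN.
      unfold w. field. lra.
    - replace (Finite 0) with (Rbar_mult (delta / h) (Rbar_inv p_infty))
        by (simpl; f_equal; ring).
      apply is_lim_seq_scal_l, is_lim_seq_inv; [apply is_lim_seq_INR | discriminate]. }
  assert (HB' : forall N, (1 <= N)%nat -> B N = RtoC (c * (wallis p - wallis_upto p (w N)))).
  { intros N HN. rewrite (HB N HN).
    replace (INR m / 2) with (INR (S p)) by (rewrite HmR, S_INR; field).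
    replace ((INR m - 1) / 2) with (INR p + 1 / 2) by (rewrite HmR; field).
    change (h * INR N / delta) with (w N).
    rewrite hyp2F1_half_neg by nra.
    rewrite euler_int_real, <- !RtoC_mult, <- RtoC_minus, <- !RtoC_mult.
    f_equal. rewrite S_INR.
    rewrite <- (Gamma_quotient p), <- (wallis_upto_integral p (w N)).
    unfold c, w.
    assert (HG : Gamma (INR p + 1) <> 0).
    { destruct (Gamma_ratio p) as (a & b & _ & Hb & Hb0 & _).
      rewrite (is_Gamma_unique _ _ Hb). lra. }
    set (I := RInt _ _ _). field. repeat split; try assumption; lra. }
  assert (Hg : forall N, (1 <= N)%nat ->
    M * exp (delta * t) / (PI * delta ^ m) *
      (1 / (INR m - 1) * (delta / (h * INR N)) ^ (m - 1)) * nrm =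
    c * ((/ w N) ^ (2 * p + 1) / (2 * INR p + 1))).
  { intros N HN. apply le_INR in HN. simpl in HN.
    replace (m - 1)%nat with (2 * p + 1)%nat by lia.
    replace (delta / (h * INR N)) with (/ w N) by (unfold w; field; lra).
    replace (INR m - 1) with (2 * INR p + 1) by (rewrite HmR; ring).
    unfold c. field. repeat split; try assumption; lra. }
  intros eps. assert (H1 : eventually (fun N => (1 <= N)%nat)) by (exists 1%nat; auto).
  generalize (filter_and _ _ H1 (wallis_tail_equiv p c w Hw Hlim eps)).
  apply filter_imp. intros N [HN H]. rewrite (HB' N HN), (Hg N HN). exact H.
Qed.
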